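(* Let $\mathcal{L}$ be a language of expressions with a fixed system of axioms of equivalence, and let $G^{equiv} = \langle N^{equiv}, E^{equiv}\rangle$ be its graph of the space of equivalences. Let $n_i, n_j \in N^{equiv}$ be two expressions. If there is any path from $n_i$ to $n_j$ in $G^{equiv}$, then $n_i \equiv n_j$.
   Context: Expression graphs. An expression graph $G = \langle n_{root}, N, E\rangle$ is a directed dataflow graph with labelled nodes: each node models an n-ary operation or an input operand (a node with no predecessor is an input value), and a directed edge connects the producer of a value to a node consuming it. The unique root $n_{root}$ is the only node without successor and produces the output value. There are no dangling edges and no unconnected nodes. Expressions of the language $\mathcal{L}$ are represented by expression graphs. Semantics. A fixed interpretation of the operators is given, so every expression computes an output value from the values assigned to its input variables. Two expressions are (semantically) equivalent, written $\equiv$, if they always produce the same output for all possible inputs (identical semantics). In contrast, $=$ denotes complete structural identity (same graph structure and same node labels). Axioms. A graph pattern is an unambiguous structural description of a (sub)graph that can be deterministically matched in any expression graph. An axiom of equivalence $A : \langle P_{match}, P_{replace}\rangle$, with $P_{match}, P_{replace}$ graph patterns, is a semantics-preserving rewrite rule: it is applicable at node $x$ of $G$ when $P_{match}$ succeeds on the subgraph of $G$ rooted at $x$, and then $A(x,G)$, obtained by applying $P_{replace}$ at $x$, is again an expression graph, with semantics identical to that of $G$. Graph of the space of equivalences. Given $\mathcal{L}$ and the axiom system, $G^{equiv} = \langle N^{equiv}, E^{equiv}\rangle$ is the (possibly infinite) directed multigraph with one node $n_l \in N^{equiv}$ for each expression $l \in \mathcal{L}$ (nodes are identified with expressions), and an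 edge $e^{A,x}_{n_i,n_j} : n_i \to n_j$ in $E^{equiv}$, labelled by an axiom $A$ of the system and a position $x$ in $n_i$ where $A$ is applicable, if and only if $n_j = A(x, n_i)$. Paths are directed paths. *)

(* Defs.v *)
From mathcomp Require Import all_boot.

Set Implicit Arguments.
Unset Strict Implicit.
Unset Printing Implicit Defensive.

Record signature := Signature {
  var : Type;
  op : Type;
  arity : op -> nat }.

(* Constants are operators of arity 0: like the variables, they label nodes
   without predecessor. *)
Inductive label (S : signature) : Type :=
| Input of var S
| Oper of op S.

Definition label_arity (S : signature) (l : label S) : nat :=
  match l with Input _ => 0 | Oper f => arity f end.

(* The incoming edges of a node are ordered: operators need not be commutative,
   and the same value may be used twice, as in x + x.  Acyclicity of a finite
   graph is expressed as well-foundedness of its edges, so that node values can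
   be computed by recursion. *)
Record dag (S : signature) := Dag {
  node :> finType;
  lab : node -> label S;
  operands : forall v : node, (label_arity (lab v)).-tuple node;
  acyclic : well_founded (fun u v => u \in operands v) }.

Arguments lab {S d} v.
Arguments operands {S d} v.

(* [depends v u]: there is an edge from the producer u to the consumer v. *)
Definition depends (S : signature) (D : dag S) : rel D :=
  fun v u => u \in operands v.
Arguments depends {S D} v u /.

Fact dag_no_cycle (S : signature) (D : dag S) (u v : D) :
  v \in operands u -> ~~ connect depends v u.
Proof.
elim/(well_founded_ind (@acyclic _ D)): u v => u IH v uv.
apply/negP => /connectP[[|z p] /= + eu].
  by move=> _; subst v; have := IH u uv u uv; rewrite connect0.
case/andP=> vz pz; have := IH v uv z vz; case/negP.
apply: (@connect_trans _ _ u); last exact: connect1.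
by apply/connectP; exists p.
Qed.

Record egraph (S : signature) := EGraph {
  dag_of :> dag S;
  root_node : dag_of;
  root_unique : forall v : dag_of,
    (forall w, v \notin operands w) <-> v = root_node;
  root_connected : forall v : dag_of, connect depends root_node v }.

Arguments root_node {S e}.

(* The relation "=" on expressions: same graph structure and same labels.  The
   identity of the nodes is immaterial, so this is isomorphism, not Leibniz
   equality of the records. *)
Definition is_iso (S : signature) (G H : egraph S) (phi : G -> H) : Prop :=
  [/\ bijective phi,
      forall v, lab (phi v) = lab v,
      forall v, operands (phi v) = map phi (operands v) :> seq H
    & phi root_node = root_node].

Definition same_graph (S : signature) (G H : egraph S) : Prop :=
  exists phi : G -> H, is_iso phi.

Section Reach.
Variables (S : signature) (D : dag S) (r : D).

Let V := {v : D | connect depends r v}.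

Fact reach_operand (v : V) (i : 'I_(label_arity (lab (val v)))) :
  connect depends r (tnth (operands (val v)) i).
Proof.
by apply: connect_trans (valP v) (connect1 _); rewrite /= mem_tnth.
Qed.

Definition reach_operands (v : V) : (label_arity (lab (val v))).-tuple V :=
  [tuple exist _ (tnth (operands (val v)) i) (reach_operand i) | i < _].

Fact reach_operandsE (v : V) :
  map val (reach_operands v) = operands (val v) :> seq D.
Proof.
rewrite /= -map_comp -[RHS]map_tnth_enum -val_ord_tuple.
by apply: eq_map.
Qed.

Fact mem_reach_operands (u v : V) :
  (u \in reach_operands v) = (val u \in operands (val v)).
Proof. by rewrite -(mem_map val_inj) reach_operandsE. Qed.

Fact reach_acyclic : well_founded (fun u v => u \in reach_operands v).
Proof.
move=> v; move: {2}(val v) (erefl (val v)) => x.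
elim/(well_founded_ind (@acyclic _ D)): x v => x IH v vx.
constructor=> u; rewrite mem_reach_operands vx => ux; exact: IH ux _ erefl.
Qed.

Definition reach_dag : dag S :=
  @Dag S V (fun v => lab (val v)) reach_operands reach_acyclic.

Definition reach_root : reach_dag := exist _ r (connect0 _ r).

Fact reach_connected (v : reach_dag) : connect depends reach_root v.
Proof.
have [p rp vp] := connectP (valP v).
elim/last_ind: p v rp vp => [|p y IH] v.
  by move=> _ /= vr; rewrite (_ : v = reach_root) ?connect0 //; apply: val_inj.
rewrite rcons_path last_rcons => /andP[rp py] vy.
have rl : connect depends r (last r p) by apply/connectP; exists p.
apply: (@connect_trans _ _ (exist _ (last r p) rl)); first exact: IH.
by apply: connect1; rewrite /= mem_reach_operands vy.
Qed.

Fact reach_unique (v : reach_dag) :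
  (forall w, v \notin operands w) <-> v = reach_root.
Proof.
split=> [nv|-> w].
  have /connectP[p] := reach_connected v.
  case/lastP: p => [|p y] //=; rewrite rcons_path last_rcons => /andP[_ py] vy.
  by case/negP: (nv (last reach_root p)); rewrite vy.
apply/negP => /dag_no_cycle; rewrite reach_connected; exact: elimF idP _.
Qed.

(* The subgraph of [D] rooted at [r]: [r] and all its direct and indirect
   operands. *)
Definition reach : egraph S :=
  @EGraph S reach_dag reach_root reach_unique reach_connected.
End Reach.

(* One type of values serves for all sorts (scalars, vectors, matrices, ...);
   [input_dom x] is the set of values that the input variable [x] may take. *)
Record interpretation (S : signature) := Interpretation {
  value : Type;
  op_sem : forall f : op S, (arity f).-tuple value -> value;
  input_dom : var S -> value -> Prop;
  input_dom_inhabited : forall x, exists d, input_dom x d }.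

Arguments value {S} i.
Arguments op_sem {S} i f _.
Arguments input_dom {S} i x d.

Definition possible_input (S : signature) (I : interpretation S)
    (env : var S -> value I) : Prop :=
  forall x, input_dom I x (env x).

Section Evaluation.
Variables (S : signature) (I : interpretation S) (env : var S -> value I).

Definition label_sem (l : label S) : (label_arity l).-tuple (value I) -> value I :=
  match l with
  | Input x => fun=> env x
  | Oper f => op_sem I f
  end.

Fixpoint eval_acc (D : dag S) (v : D)
    (a : Acc (fun u w : D => u \in operands w) v) {struct a} : value I :=
  label_sem [tuple eval_acc (Acc_inv a (mem_tnth i (operands v)))
            | i < label_arity (lab v)].

Definition eval (D : dag S) (v : D) : value I := eval_acc (@acyclic S D v).

Fact eval_accE (D : dag S) (v : D) a : @eval_acc D v a = eval v.
Proof.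
rewrite /eval; move: (acyclic v) => b.
elim/(well_founded_ind (@acyclic _ D)): v a b => v IH [a] [b] /=.
by congr label_sem; apply: eq_mktuple => i; apply: IH; apply: mem_tnth.
Qed.

Fact evalE (D : dag S) (v : D) :
  eval v = label_sem (map_tuple (@eval D) (operands v)).
Proof.
rewrite -{1}(eval_accE (Acc_intro v (fun u _ => acyclic u))) /=.
congr label_sem; apply: eq_from_tnth => i.
by rewrite tnth_mktuple tnth_map eval_accE.
Qed.

Definition output (G : egraph S) : value I := eval (root_node : G).
End Evaluation.

Definition equivalent (S : signature) (I : interpretation S) (G H : egraph S) :
    Prop :=
  forall env : var S -> value I,
    possible_input env -> output env G = output env H.

(* A pattern to be matched is any deterministic test on rooted graphs that only
   depends on their structure and labels. *)
Record match_pattern (S : signature) := MatchPattern {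
  matches : egraph S -> bool;
  matches_structural : forall G H, same_graph G H -> matches G = matches H }.

Coercion matches : match_pattern >-> Funclass.

(* What is to be substituted for the root of a matched graph [H]: a graph whose
   nodes are either fresh or nodes of [H], the latter keeping their label and
   operands.  Its root may itself be a node of [H], as for x + 0 --> x. *)
Record replacement (S : signature) (H : egraph S) := Replacement {
  fresh : finType;
  fresh_lab : fresh -> label S;
  fresh_operands :
    forall v, (label_arity (fresh_lab v)).-tuple (fresh + H)%type;
  new_root : (fresh + H)%type;
  fresh_acyclic : well_founded (fun u v => inl u \in fresh_operands v) }.

Arguments fresh {S H} r.
Arguments fresh_lab {S H r} v.
Arguments fresh_operands {S H r} v.
Arguments new_root {S H} r.

Definition sum_map (A A' B B' : Type) (f : A -> A') (g : B -> B') (z : A + B) :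
    A' + B' :=
  match z with inl a => inl (f a) | inr b => inr (g b) end.

Definition same_replacement (S : signature) (G H : egraph S) (phi : G -> H)
    (P : replacement G) (Q : replacement H) : Prop :=
  exists psi : fresh P -> fresh Q,
    [/\ bijective psi,
        forall v, fresh_lab (psi v) = fresh_lab v,
        forall v, fresh_operands (psi v) =
          map (sum_map psi phi) (fresh_operands v) :> seq (fresh Q + H)
      & new_root Q = sum_map psi phi (new_root P)].

(* The replacement is determined by the matched graph, up to the identity of
   the nodes. *)
Record replace_pattern (S : signature) := ReplacePattern {
  replace : forall H : egraph S, replacement H;
  replace_structural : forall (G H : egraph S) (phi : G -> H),
    is_iso phi -> same_replacement phi (replace G) (replace H) }.

Coercion replace : replace_pattern >-> Funclass.

Section Graft.
Variables (S : signature) (G : egraph S) (x : G) (P : replacement (reach x)).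

Let V : finType := (fresh P + G)%type.

Definition embed : fresh P + reach x -> V := sum_map id val.

Definition redirect (z : G) : V := if z == x then embed (new_root P) else inr z.

Definition graft_lab (v : V) : label S :=
  match v with inl f => fresh_lab f | inr y => lab y end.

(* Every use of [x] in [G] becomes a use of the root of [P]; the occurrences of
   [x] inside [P] still denote the old node. *)
Definition graft_operands (v : V) : (label_arity (graft_lab v)).-tuple V :=
  match v with
  | inl f => map_tuple embed (fresh_operands f)
  | inr y => map_tuple redirect (operands y)
  end.

Fact graft_acyclic : well_founded (fun u v => u \in graft_operands v).
Proof.
pose R (u v : V) := u \in graft_operands v.
have accH (y : G) : connect depends x y -> Acc R (inr y).
  elim/(well_founded_ind (@acyclic _ G)): y => y IH xy; constructor=> u.
  case/mapP=> z yz ->; rewrite /redirect; case: eqP => [zx|_].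
    by subst z; have := dag_no_cycle yz; rewrite xy.
  by apply: IH => //; apply: connect_trans xy (connect1 _).
have accE (z : fresh P + reach x) :
    (forall f, z = inl f -> Acc R (inl f)) -> Acc R (embed z).
  by case: z => [f|y] accz; [apply: accz | apply: accH (valP y)].
have accF (f : fresh P) : Acc R (inl f).
  elim/(well_founded_ind (@fresh_acyclic _ _ P)): f => f IH; constructor=> u.
  by case/mapP=> z fz ->; apply: accE => g zg; apply: IH; rewrite -zg.
case=> [|y]; first exact: accF.
elim/(well_founded_ind (@acyclic _ G)): y => y IH; constructor=> u.
case/mapP=> z yz ->; rewrite /redirect; case: eqP => _; last exact: IH.
by apply: accE => f _; apply: accF.
Qed.

Definition graft_dag : dag S := @Dag S V graft_lab graft_operands graft_acyclic.

(* The nodes that are no longer used are dropped. *)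
Definition graft : egraph S := reach (redirect root_node : graft_dag).
End Graft.

Record language (S : signature) := Language {
  expr : egraph S -> Prop;
  expr_structural : forall G H, same_graph G H -> expr G -> expr H }.

Coercion expr : language >-> Funclass.

Definition applicable (S : signature) (M : match_pattern S) (G : egraph S)
    (x : G) : bool :=
  M (reach x).

Definition rewrite_at (S : signature) (Q : replace_pattern S) (G : egraph S)
    (x : G) : egraph S :=
  graft (Q (reach x)).

(* [rewrite_at] is an expression graph by construction; identical semantics is
   only required of rewritings of expressions of the language, which may be
   restricted, for example to well-sorted graphs. *)
Record equiv_axiom (S : signature) (I : interpretation S) (L : language S) :=
  EquivAxiom {
    P_match : match_pattern S;
    P_replace : replace_pattern S;
    semantics_preserving : forall (G : egraph S) (x : G),
      L G -> applicable P_match x -> equivalent I (rewrite_at P_replace x) G }.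

(* The nodes of the graph of the space of equivalences, identified up to
   [same_graph]. *)
Record space_node (S : signature) (L : language S) := SpaceNode {
  graph_of :> egraph S;
  graph_of_expr : L graph_of }.

Section Space.
Variables (S : signature) (I : interpretation S) (L : language S).
Variables (Ax : Type) (ax : Ax -> equiv_axiom I L).

Record space_edge (ni nj : space_node L) : Type := SpaceEdge {
  edge_axiom : Ax;
  edge_position : ni;
  edge_applicable : applicable (P_match (ax edge_axiom)) edge_position;
  edge_target :
    same_graph nj (rewrite_at (P_replace (ax edge_axiom)) edge_position) }.

(* The empty path joins [ni] and [nj] when they are the same node, that is, the
   same expression. *)
Inductive space_path : space_node L -> space_node L -> Type :=
| PathNil (ni nj : space_node L) : same_graph ni nj -> space_path ni nj
| PathCons (ni nk nj : space_node L) :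
    space_edge ni nk -> space_path nk nj -> space_path ni nj.
End Space.

(* Main.v *)
Require Import Defs.
From mathcomp Require Import all_boot.

(** Induction on the path: each edge applies a semantics-preserving axiom, and equalities of outputs
    chain. Since nodes count only up to isomorphism, the empty path and edge targets also need
    [output_same_graph]: isomorphisms preserve values, by induction along operands ([eval_iso]). *)

(** The tuple types depend on the labels, so operand values are compared as sequences. *)
Lemma eq_label_sem (S : signature) (I : interpretation S) (env : var S -> value I)
    (l l' : label S) (t : (label_arity l).-tuple (value I))
    (t' : (label_arity l').-tuple (value I)) :
  l = l' -> t = t' :> seq _ -> label_sem env t = label_sem env t'.
Proof. by move=> ll'; case: l' / ll' t' => t' /val_inj->. Qed.

Lemma eval_iso (S : signature) (I : interpretation S) (env : var S -> value I)
    (G H : egraph S) (phi : G -> H) (v : G) :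
  is_iso phi -> eval env (phi v) = eval env v.
Proof.
case=> _ labE opE _; elim/(well_founded_ind (@acyclic _ G)): v => v IH.
rewrite !evalE; apply: eq_label_sem; first exact: labE.
by rewrite /= opE -map_comp; apply/eq_in_map => u /IH.
Qed.

Lemma output_same_graph (S : signature) (I : interpretation S)
    (env : var S -> value I) (G H : egraph S) :
  same_graph G H -> output env G = output env H.
Proof.
case=> phi isoP; have [_ _ _ rootE] := isoP.
by rewrite /output -rootE eval_iso.
Qed.

Theorem theorem3p10 (S : signature) (I : interpretation S) (L : language S)
    (Ax : Type) (ax : Ax -> equiv_axiom I L) (ni nj : space_node L) :
  space_path ax ni nj -> equivalent I ni nj.
Proof.
elim=> {ni nj} [ni nj same | ni nk nj [A x matchx target] _ IH] env env_ok.
  exact: output_same_graph.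
(* Passes from [nj] back to [nk], then to the rewritten graph itself. *)
rewrite -IH // (output_same_graph _ _ env _ _ target); apply/esym.
exact: (semantics_preserving (graph_of_expr ni) matchx env_ok).
Qed.
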